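(* Let $I=(0,\infty)$, $f:I\to\mathbb{R}$, let $X_0\subset\mathbb{R}$ be an interval of positive length, and let $p\ge3$ be an integer. Suppose that for every kernel $H:X_0\times X_0\to\mathbb{R}$ of the form $H(x,y) = c_1u_1^{x+y} + c_2u_2^{x+y}$ with $u_1,u_2>0$, $c_1,c_2\ge0$, $c_1+c_2>0$, the kernel $f\circ H$ is $\mathrm{TN}_p$ on $X_0\times X_0$. Then $f\in C^{p-3}(I)$, $f^{(p-3)}$ is convex on $I$, and $f,f',\dots,f^{(p-3)}\ge0$ on $I$. If moreover $f\in C^{p-1}(I)$, then also $f^{(p-2)},f^{(p-1)}\ge0$ on $I$.
   Context: For $X \subset \mathbb{R}$, a kernel $K : X \times X \to \mathbb{R}$ is $\mathrm{TN}_p$ if $\det (K(x_j,y_k))_{j,k=1}^r \geq 0$ for all $1 \leq r \leq p$ and all real $x_1<\dots<x_r$, $y_1<\dots<y_r$ in $X$. *)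

(* Defs.v *)
From HB Require Import structures.
From mathcomp Require Import all_boot all_order all_algebra.
From mathcomp Require Import all_classical all_reals all_analysis.
Set Implicit Arguments. Unset Strict Implicit. Unset Printing Implicit Defensive.
Import Order.TTheory GRing.Theory Num.Theory.
Import numFieldNormedType.Exports.
Local Open Scope classical_set_scope.
Local Open Scope ring_scope.

Definition TN {R : realType} (p : nat) (X : set R) (K : R -> R -> R) : Prop :=
  forall r : nat, (1 <= r)%N -> (r <= p)%N ->
  forall x y : 'I_r -> R,
    (forall i, X (x i)) -> (forall i, X (y i)) ->
    (forall i j : 'I_r, (i < j)%N -> x i < x j) ->
    (forall i j : 'I_r, (i < j)%N -> y i < y j) ->
    0 <= \det (\matrix_(j < r, k < r) K (x j) (y k)).

Definition Ck_on {R : realType} (k : nat) (f : R -> R) (I : set R) : Prop :=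
  (forall j : nat, (j < k)%N -> forall x, I x -> derivable (derive1n j f) x 1)
  /\ (forall x, I x -> {for x, continuous (derive1n k f)}).

Definition convex_on {R : realType} (g : R -> R) (I : set R) : Prop :=
  forall x y t : R, I x -> I y -> 0 <= t -> t <= 1 ->
    g (t * x + (1 - t) * y) <= t * g x + (1 - t) * g y.

(* Main.v *)
Require Import Defs.
From HB Require Import structures.
From mathcomp Require Import all_boot all_order all_algebra.
From mathcomp Require Import all_classical all_reals all_analysis.
From mathcomp Require Import ring lra zify.
Import Order.TTheory GRing.Theory Num.Theory.
Import numFieldNormedType.Exports.
Local Open Scope classical_set_scope.
Local Open Scope ring_scope.

(** With [u1 = 1] and exponents [x_j] affine in [ln v_j], the hypothesis at equal arguments
    says that the symmetric matrices [f (t + h v_j v_k)] have nonnegative principal minors,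
    hence are positive semidefinite.  The resulting inequalities
    [\sum_{j,k} a_j a_k f (t + h v_j v_k) >= 0] are linear in [f].  If [\sum_j a_j v_j^l] is
    [0] for [l < m] and [1] for [l = m], then the [m]-th derivative in [h] at [h = 0] of the
    left side is [f^(m)(t)], while all lower ones vanish; so smooth [f] have
    [f^(m) >= 0] for [m <= p - 1].  The 2 x 2 minors make [f] monotone and continuous.  For
    continuous [f], let [F] be an [m]-fold antiderivative: the smooth case applied to a mixed
    difference of order [m] of [F], which inherits the linear inequalities, says that the mixed
    differences of [f] of order [m] are nonnegative.  A function with nonnegative mixed
    differences of orders [0, ..., n + 1] ([n >= 1]) is convex,
    and for [n >= 2] it is differentiable with
    a derivative having nonnegative mixed differences of orders [0, ..., n]; induction
    gives the regularity statement. *)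

(** * Positive semidefiniteness from principal minors *)

Definition gram {R : realType} {T : Type} (K : T -> T -> R) (x0 : T) (s : seq T) :
    'M[R]_(size s) :=
  \matrix_(i, j) K (nth x0 s i) (nth x0 s j).

Definition schur {R : realType} {T : Type} (K : T -> T -> R) (z x y : T) : R :=
  K x y - K x z * K z y / K z z.

(** One step of Gaussian elimination with pivot [K z z]: the matrix factors into a unit lower and an
    upper block triangular matrix, the last block of the latter being the Schur complement. *)
Lemma det_gram_cons (R : realType) (T : Type) (K : T -> T -> R) (x0 z : T) (s : seq T) :
  K z z != 0 -> \det (gram K x0 (z :: s)) = K z z * \det (gram (schur K z) x0 s).
Proof.
move=> Kz.
pose Aul : 'M[R]_1 := (K z z)%:M.
pose Aur : 'M[R]_(1, size s) := \row_j K z (nth x0 s j).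
pose L : 'M[R]_(size s, 1) := \col_i (K (nth x0 s i) z / K z z).
have E : gram K x0 (z :: s) =
  block_mx 1%:M 0 L 1%:M *m block_mx Aul Aur 0 (gram (schur K z) x0 s)
  :> 'M[R]_(1 + size s).
  rewrite mulmx_block !mul1mx !mul0mx !addr0.
  rewrite -[LHS](@submxK _ 1 (size s) 1 (size s)); congr block_mx; apply/matrixP => i j.
  - by rewrite !mxE !ord1.
  - by rewrite !mxE !ord1.
  - by rewrite !mxE !ord1 big_ord1 !mxE /= divfK.
  - by rewrite !mxE big_ord1 !mxE /= /schur mulrAC addrC subrK.
rewrite -[LHS]/(\det (gram K x0 (z :: s) : 'M[R]_(1 + size s))) E.
by rewrite det_mulmx det_lblock det_ublock !det1 !mul1r det_scalar expr1.
Qed.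

(** Induction on [s] by completing the square in the coefficient [a z]. Indexing by lists turns
    principal minors into subsequences; by [det_gram_cons], a minor of the Schur complement is a
    minor of [K] through [z] divided by [K z z], so the hypothesis is inherited. *)
Lemma quad_form_ge0 (R : realType) (T : eqType) (a : T -> R) (x0 : T) (s : seq T)
    (K : T -> T -> R) :
  (forall x y, K x y = K y x) ->
  (forall s', subseq s' s -> 0 <= \det (gram K x0 s')) ->
  0 <= \sum_(x <- s) \sum_(y <- s) a x * a y * K x y.
Proof.
elim: s K => [|z s IH] K Ksym Kdet; first by rewrite big_nil.
have Kss s' : subseq s' s -> 0 <= \det (gram K x0 s').
  by move=> s's; apply: Kdet; exact: subseq_trans s's (subseq_cons _ _).
pose B := \sum_(y <- s) a y * K z y.
have expand : \sum_(x <- z :: s) \sum_(y <- z :: s) a x * a y * K x y =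
    a z ^+ 2 * K z z + 2 * a z * B + \sum_(x <- s) \sum_(y <- s) a x * a y * K x y.
  rewrite big_cons big_cons.
  under [X in _ + X]eq_bigr do rewrite big_cons.
  rewrite big_split /=.
  have -> : \sum_(y <- s) a z * a y * K z y = a z * B.
    by rewrite /B mulr_sumr; apply: eq_bigr => y _; rewrite mulrA.
  have -> : \sum_(x <- s) a x * a z * K x z = a z * B.
    by rewrite /B mulr_sumr; apply: eq_bigr => y _; rewrite Ksym; ring.
  by ring.
rewrite expand.
have Kz0 : 0 <= K z z.
  have := Kdet [:: z]; rewrite sub1seq mem_head => /(_ isT).
  by rewrite (det_mx11 (gram K x0 [:: z])) mxE.
(* A zero pivot forces its whole row to vanish: the 2 x 2 minor on [z, y] is then [- K z y ^+ 2]. *)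
have [Kz|Kz] := eqVneq (K z z) 0.
- have B0 : B = 0.
    rewrite /B big_seq big1 // => y ys.
    have sub : subseq [:: z; y] (z :: s) by rewrite /= eqxx sub1seq.
    have /= := Kdet _ sub.
    have -> : \det (gram K x0 [:: z; y]) = K z z * K y y - K z y * K y z.
      rewrite (expand_det_row (gram K x0 [:: z; y] : 'M[R]_2) ord0) !big_ord_recl big_ord0.
      by rewrite /cofactor !det_mx11 !mxE /= /bump /= expr0 expr1; ring.
    rewrite Kz (Ksym y z) mul0r sub0r oppr_ge0 -expr2 => h.
    have /eqP : K z y ^+ 2 = 0 by apply/eqP; rewrite eq_le h sqr_ge0.
    by rewrite sqrf_eq0 => /eqP ->; rewrite mulr0.
  rewrite Kz B0 !mulr0 !add0r; exact: IH.
- have Kzp : 0 < K z z by rewrite lt_def Kz.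
  have := IH (schur K z).
  have -> : \sum_(x <- s) \sum_(y <- s) a x * a y * schur K z x y =
     \sum_(x <- s) \sum_(y <- s) a x * a y * K x y - B ^+ 2 / K z z.
    rewrite /schur.
    under eq_bigr => x _ do
      (under eq_bigr => y _ do rewrite mulrBr; rewrite sumrB).
    rewrite sumrB; congr (_ - _).
    rewrite expr2 /B !mulr_suml; apply: eq_bigr => x _.
    rewrite mulr_sumr mulr_suml; apply: eq_bigr => y _.
    by rewrite (Ksym x z); ring.
  set S := \sum_(x <- s) _ => h.
  have {h} h : 0 <= S - B ^+ 2 / K z z.
    apply: h => [x y|s' s's].
      by rewrite /schur (Ksym x y) (Ksym x z) (Ksym z y); ring.
    rewrite -(pmulr_rge0 _ Kzp) -det_gram_cons //.
    by apply: Kdet; rewrite /= eqxx.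
  have -> : a z ^+ 2 * K z z + 2 * a z * B + S =
     (a z * K z z + B) ^+ 2 / K z z + (S - B ^+ 2 / K z z) by field.
  by rewrite addr_ge0 // divr_ge0 // sqr_ge0.
Qed.

(** * Quadratic inequalities extracted from the kernel hypothesis *)

Lemma vanishing_moments (R : realType) (m : nat) :
  exists a : nat -> R,
    (forall l, (l < m)%N -> \sum_(j < m.+1) a j * j.+1%:R ^+ l = 0) /\
    \sum_(j < m.+1) a j * j.+1%:R ^+ m = 1.
Proof.
pose V : 'M[R]_m.+1 := Vandermonde m.+1 (\row_j j.+1%:R).
have Vu : V \in unitmx.
  rewrite unitmxE det_Vandermonde unitfE prodf_seq_neq0; apply/allP => i _ /=.
  rewrite prodf_seq_neq0; apply/allP => j _ /=; apply/implyP => ij.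
  by rewrite !mxE subr_eq0 eqr_nat eqSS gt_eqF.
(* The weights are the last column of the inverse Vandermonde matrix at the nodes [1, ..., m + 1],
   which are positive, as the [v i] below have to be. *)
pose c : 'cV[R]_m.+1 := invmx V *m delta_mx ord_max 0.
have Vc : V *m c = delta_mx ord_max 0 by rewrite mulKVmx.
have moment (l : 'I_m.+1) : \sum_(j < m.+1) c (inord j) 0 * j.+1%:R ^+ l = (l == ord_max)%:R.
  have /matrixP/(_ l 0) := Vc; rewrite !mxE andbT => <-.
  by apply: eq_bigr => j _; rewrite !mxE inord_val mulrC.
exists (fun j => c (inord j) 0); split => [l lm|].
  have := moment (Ordinal (ltnW lm : (l < m.+1)%N)) => /= ->.
  by rewrite -val_eqE /= ltn_eqF.
by have /= -> := moment ord_max; rewrite eqxx.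
Qed.

Lemma TN_rank_two_det (R : realType) (f : R -> R) (X0 : set R) (p : nat) :
  is_interval X0 ->
  (exists a b : R, [/\ a < b, X0 a & X0 b]) ->
  (forall u1 u2 c1 c2 : R, 0 < u1 -> 0 < u2 -> 0 <= c1 -> 0 <= c2 ->
     0 < c1 + c2 ->
     TN p X0 (fun x y => f (c1 * u1 `^ (x + y) + c2 * u2 `^ (x + y)))) ->
  forall (t h : R) (r : nat) (v : 'I_r -> R), 0 <= t -> 0 < h ->
    (1 <= r <= p)%N -> (forall i, 0 < v i) ->
    (forall i j : 'I_r, (i < j)%N -> v i < v j) ->
    0 <= \det (\matrix_(i < r, j < r) f (t + h * (v i * v j))).
Proof.
move=> X0itv [a [b [ab Xa Xb]]] HTN t h r v t0 h0 /andP[r1 rp] v0 vlt.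
(* [L] bounds every [ln (v i)] in absolute value, so the scale [s] keeps all the points [x i] within
   [[a, b]]; the summand 1 makes [L] positive. *)
pose L : R := 1 + \sum_i `|ln (v i)|.
have L0 : 0 < L by rewrite ltr_pwDl // sumr_ge0.
have vL i : `|ln (v i)| <= L.
  rewrite /L (bigD1 i) //= addrCA lerDl addr_ge0 // sumr_ge0 //.
pose s : R := (b - a) / (2 * L).
have s0 : 0 < s by rewrite divr_gt0 ?mulr_gt0 // subr_gt0.
pose mid : R := (a + b) / 2.
pose x i : R := mid + s * ln (v i).
have Xx i : X0 (x i).
  apply: (X0itv a b) => //; have := vL i; rewrite ler_norml => /andP[h1 h2].
  have e : s * L = (b - a) / 2 by rewrite /s; field; rewrite gt_eqF.
  have h1' : - ((b - a) / 2) <= s * ln (v i) by rewrite -e -mulrN ler_wpM2l // ltW.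
  have h2' : s * ln (v i) <= (b - a) / 2 by rewrite -e ler_wpM2l // ltW.
  by rewrite /x /mid; apply/andP; split; lra.
pose u : R := expR s^-1.
pose c : R := h * expR (- (2 * mid / s)).
have c0 : 0 < c by rewrite mulr_gt0 // expR_gt0.
have xlt (i j : 'I_r) : (i < j)%N -> x i < x j.
  by move=> ij; rewrite ltrD2l ltr_pM2l // ltr_ln ?posrE ?v0 // vlt.
have := HTN 1 u t c ltr01 (expR_gt0 _) t0 (ltW c0) (ltr_wpDl t0 c0) r r1 rp x x Xx Xx xlt xlt.
congr (0 <= \det _); apply/matrixP => i j; rewrite !mxE powR1 mulr1; congr (f (_ + _)).
rewrite /u /powR gt_eqF ?expR_gt0 // expRK /c -mulrA -expRD; congr (_ * _).
rewrite -[v i]lnK ?posrE ?v0 // -[v j in RHS]lnK ?posrE ?v0 // -expRD; congr expR.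
by rewrite /x; field; rewrite gt_eqF.
Qed.

Lemma TN_quad_form (R : realType) (f : R -> R) (p : nat) :
  (forall (t h : R) (r : nat) (v : 'I_r -> R), 0 <= t -> 0 < h ->
    (1 <= r <= p)%N -> (forall i, 0 < v i) ->
    (forall i j : 'I_r, (i < j)%N -> v i < v j) ->
    0 <= \det (\matrix_(i < r, j < r) f (t + h * (v i * v j)))) ->
  forall (a : nat -> R) (m : nat) (t h : R), (m < p)%N -> 0 <= t -> 0 < h ->
  0 <= \sum_(i : 'I_m.+1 * 'I_m.+1) a i.1 * a i.2 * f (t + h * (i.1.+1%:R * i.2.+1%:R)).
Proof.
move=> Hdet a m t h mp t0 h0.
rewrite -(pair_bigA _ (fun i j : 'I_m.+1 => a i * a j * f (t + h * (i.+1%:R * j.+1%:R)))) /=.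
have := @quad_form_ge0 R nat a 0%N (iota 0 m.+1)
  (fun i j => f (t + h * (i.+1%:R * j.+1%:R))).
have e (F : nat -> R) : \sum_(i < m.+1) F i = \sum_(i <- iota 0 m.+1) F i.
  by rewrite -(big_mkord predT F) /index_iota subn0.
have e2 (F : nat -> nat -> R) : \sum_(i < m.+1) \sum_(j < m.+1) F i j =
    \sum_(i <- iota 0 m.+1) \sum_(j <- iota 0 m.+1) F i j.
  by rewrite -(e (fun i => \sum_(j <- _) F i j)); apply: eq_bigr => i _; exact: e.
rewrite (e2 (fun i j => a i * a j * f (t + h * (i.+1%:R * j.+1%:R)))).
apply => [i j|s sub]; first by rewrite (mulrC i.+1%:R).
(* The empty minor is 1; it is treated apart because [Hdet] asks for [1 <= r]. *)
have [->|sn] := eqVneq s [::]; first by rewrite det_mx00.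
have ssz : (size s <= m.+1)%N by have := size_subseq sub; rewrite size_iota.
apply: Hdet => //.
- by rewrite lt0n size_eq0 sn (leq_trans ssz).
- have ss : sorted ltn s := subseq_sorted ltn_trans sub (iota_ltn_sorted _ _).
  move=> i j ij; rewrite ltr_nat ltnS.
  by have := sorted_ltn_nth ltn_trans 0%N ss; apply; rewrite ?inE.
Qed.

(** * Mixed differences, antiderivatives and the moment argument *)

Definition fdelta {R : realType} (h : R) (f : R -> R) : R -> R :=
  fun x => f (x + h) - f x.

Fixpoint fdiff {R : realType} (hs : seq R) (f : R -> R) : R -> R :=
  if hs is h :: hs' then fdiff hs' (fdelta h f) else f.

Lemma is_derive_continuous (R : realType) (f : R -> R) (x d : R) :
  is_derive x 1 f d -> {for x, continuous f}.
Proof.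
by move=> fd; apply/differentiable_continuous/derivable1_diffP; exact: ex_derive.
Qed.

Lemma is_derive_comp_affine (R : realType) (g : R -> R) (x s h d : R) :
  is_derive (x + h * s) 1 g d -> is_derive h 1 (fun h => g (x + h * s)) (d * s).
Proof.
move=> gd; apply: (@is_derive1_comp R g (fun h => x + h * s)) => //.
have -> : (fun h : R => x + h * s) = cst x + (id * cst s).
  by apply/funext.
by apply: is_derive_eq; rewrite scaler0 add0r add0r /GRing.scale /= mulr1.
Qed.

Lemma is_derive_comp_addr (R : realType) (g : R -> R) (x h d : R) :
  is_derive (x + h) 1 g d -> is_derive x 1 (fun x => g (x + h)) d.
Proof.
move=> gd; have := @is_derive_comp_affine R g h 1 x d.
rewrite !mulr1 addrC => /(_ gd).
by under eq_fun do rewrite mulr1 addrC.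
Qed.

Lemma is_derive_sumr (R : realType) (I : Type) (r : seq I) (F : I -> R -> R)
    (d : I -> R) (x : R) :
  (forall i, is_derive x 1 (F i) (d i)) ->
  is_derive x 1 (fun x => \sum_(i <- r) F i x) (\sum_(i <- r) d i).
Proof.
move=> Fd; elim: r => [|i r IH].
  by rewrite big_nil; under eq_fun do rewrite big_nil; exact: is_derive_cst.
rewrite big_cons; under eq_fun do rewrite big_cons; exact: is_deriveD.
Qed.

Lemma continuous_sumr (R : realType) (I : Type) (r : seq I) (F : I -> R -> R) (x : R) :
  (forall i, {for x, continuous (F i)}) ->
  {for x, continuous (fun y => \sum_(i <- r) F i y)}.
Proof.
move=> Fc; elim: r => [|i r IH].
  rewrite (_ : (fun y => _) = cst 0); first exact: cvg_cst.
  by apply/funext => y; rewrite big_nil.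
rewrite (_ : (fun y => _) = (fun y => F i y + \sum_(j <- r) F j y)).
  exact: (@continuousD _ _ _ (F i) _ x (Fc i) IH).
by apply/funext => y; rewrite big_cons.
Qed.

Lemma is_derive_mull (R : realType) (k : R) (g : R -> R) (x d : R) :
  is_derive x 1 g d -> is_derive x 1 (fun x => k * g x) (k * d).
Proof. by move=> gd; exact: is_deriveZ. Qed.

Lemma MVT_is_derive (R : realType) (f df : R -> R) (a b : R) : a < b ->
  (forall x, a <= x <= b -> is_derive x 1 f (df x)) ->
  exists2 c, a < c < b & f b - f a = df c * (b - a).
Proof.
move=> ab fd; have [||c] := @MVT R f df a b ab.
- by move=> x; rewrite in_itv /= => /andP[ax xb]; apply: fd; rewrite !ltW.
- apply: derivable_within_continuous => x; rewrite in_itv /= => axb.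
  by have [] := fd x axb.
by rewrite in_itv; exists c.
Qed.

Lemma derive_ge0_fdelta (R : realType) (f df : R -> R) (c h x : R) :
  (forall y, c < y -> is_derive y 1 f (df y)) -> (forall y, c < y -> 0 <= df y) ->
  c < x -> 0 < h -> 0 <= fdelta h f x.
Proof.
move=> fd df0 cx h0; have xh : x < x + h by rewrite ltrDl.
have [y /andP[xy _]] := @MVT_is_derive R f df x (x + h) xh
   (fun y => fun H => fd y (lt_le_trans cx (proj1 (andP H)))).
by rewrite /fdelta => ->; rewrite mulr_ge0 ?subr_ge0 ?(ltW xh) // df0 // (lt_trans cx).
Qed.

Lemma fdiff_is_derive (R : realType) (hs : seq R) (c : R) (f df : R -> R) :
  all (fun h => 0 < h) hs ->
  (forall x, c < x -> is_derive x 1 f (df x)) ->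
  forall x, c < x -> is_derive x 1 (fdiff hs f) (fdiff hs df x).
Proof.
elim: hs f df => [|h hs IH] f df /=; first by [].
move=> /andP[h0 hs0] fd; apply: IH => // x cx.
apply: is_deriveB; last exact: fd.
by apply: is_derive_comp_addr; apply: fd; rewrite ltr_wpDr // ltW.
Qed.

Lemma fdiff_continuous (R : realType) (hs : seq R) (c : R) (f : R -> R) :
  all (fun h => 0 < h) hs ->
  (forall x, c < x -> {for x, continuous f}) ->
  forall x, c < x -> {for x, continuous (fdiff hs f)}.
Proof.
elim: hs f => [|h hs IH] f /=; first by [].
move=> /andP[h0 hs0] fc; apply: IH => // x cx.
have fxh : {for x + h, continuous f} by apply: fc; rewrite ltr_wpDr // ltW.
apply: (@continuousB _ _ _ (fun x => f (x + h)) f x _ (fc x cx)).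
apply: (@continuous_comp _ _ _ (fun x => x + h) f x) => //.
by apply: cvgD; [exact: cvg_id|exact: cvg_cst].
Qed.

Lemma fdiff_sum (R : realType) (I : Type) (r : seq I) (w s : I -> R) (h : R) (hs : seq R)
    (f : R -> R) (x : R) :
  \sum_(i <- r) w i * fdiff hs f (x + h * s i) =
  fdiff hs (fun y => \sum_(i <- r) w i * f (y + h * s i)) x.
Proof.
elim: hs f => [//|k hs IH] f /=; rewrite IH; congr (fdiff _ _ _).
apply/funext => y; rewrite /fdelta -sumrB; apply: eq_bigr => i _.
by rewrite mulrBr addrAC.
Qed.

(** Each difference is traded for one derivative by the mean value theorem, so a mixed difference of
    [P 0] takes the sign of the derivative of the same order. *)
Lemma fdiff_ge0 (R : realType) (hs : seq R) (c : R) (P : nat -> R -> R) :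
  all (fun h => 0 < h) hs ->
  (forall l, (l < size hs)%N -> forall x, c < x -> is_derive x 1 (P l) (P l.+1 x)) ->
  (forall x, c < x -> 0 <= P (size hs) x) ->
  forall x, c < x -> 0 <= fdiff hs (P 0%N) x.
Proof.
elim: hs P => [//|h hs IH] P /= /andP[h0 hs0] Pd Pn.
apply: (IH (fun l => fdelta h (P l))) => // [l ls x cx|x cx].
  have lS : (l < (size hs).+1)%N by rewrite ltnW.
  apply: is_deriveB; last exact: Pd.
  by apply: is_derive_comp_addr; apply: Pd => //; rewrite ltr_wpDr // ltW.
by apply: derive_ge0_fdelta (Pd _ _) Pn cx h0.
Qed.

(* As [h -> 0+], the sum behaves like [h ^ m / m! * (\sum_i w i * s i ^ m) * G m x]. *)
Lemma derive_moment_ge0 (R : realType) (I : Type) (r : seq I) (w s : I -> R) (m : nat)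
    (G : nat -> R -> R) (c x : R) :
  (forall i, 0 <= s i) ->
  (forall l, (l < m)%N -> \sum_(i <- r) w i * s i ^+ l = 0) ->
  0 < \sum_(i <- r) w i * s i ^+ m ->
  c < x ->
  (forall l, (l < m)%N -> forall y, c < y -> is_derive y 1 (G l) (G l.+1 y)) ->
  {for x, continuous (G m)} ->
  (forall h : R, 0 < h -> 0 <= \sum_(i <- r) w i * G 0%N (x + h * s i)) ->
  0 <= G m x.
Proof.
move=> s0 mom0 momm cx Gd Gc T0; rewrite leNgt; apply/negP => Gm0.
(* [phi l] is the [l]-th derivative in [h] of the weighted sum. *)
pose phi l (h : R) : R := \sum_(i <- r) w i * s i ^+ l * G l (x + h * s i).
have phid l (h : R) : (l < m)%N -> 0 <= h -> is_derive h 1 (phi l) (phi l.+1 h).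
  move=> lm h0; apply: is_derive_sumr => i.
  rewrite exprSr [X in X * G _ _]mulrA -mulrA [s i * _]mulrC.
  apply: is_derive_mull; apply: is_derive_comp_affine; apply: Gd => //.
  by rewrite ltr_wpDr // mulr_ge0.
have phi0 l : phi l 0 = (\sum_(i <- r) w i * s i ^+ l) * G l x.
  by rewrite /phi mulr_suml; apply: eq_bigr => i _; rewrite mul0r addr0.
have phic : {for 0, continuous (phi m)}.
  apply: continuous_sumr => i.
  suff Gsc : {for 0, continuous (fun h : R => G m (x + h * s i))}.
    by apply: cvgM Gsc; exact: cvg_cst.
  apply: (@continuous_comp _ _ _ (fun h : R => x + h * s i) (G m) 0).
    apply: cvgD; first exact: cvg_cst.
    by apply: cvgM; [exact: cvg_id|exact: cvg_cst].
  by rewrite mul0r addr0.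
have [eta eta0 phineg] : exists2 eta, 0 < eta & forall h : R, 0 < h < eta -> phi m h < 0.
  have phim0 : phi m 0 < 0 by rewrite phi0 pmulr_rlt0.
  have /cvgrPdist_lt/(_ (- phi m 0)) := phic; rewrite oppr_gt0 => /(_ phim0).
  move=> /nbhs_ballP[e /= e0 eP]; exists e => // h /andP[h0 he].
  have := eP h; rewrite /ball /= sub0r normrN gtr0_norm // => /(_ he).
  by rewrite ltr_norml => /andP[+ _]; rewrite opprK -subr_gt0 => ?; lra.
(* Descent from order [m] to order 0: since [phi l 0 = 0] for [l < m], the mean value theorem passes
   negativity on [(0, eta)] from [phi l.+1] to [phi l]. Order 0 contradicts [T0]. *)
have neg k : (k <= m)%N -> forall h : R, 0 < h < eta -> phi (m - k)%N h < 0.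
  elim: k => [|k IH] km h /andP[h0 he]; first by rewrite subn0 phineg // h0.
  have mk : (m - k.+1 < m)%N by rewrite ltn_subrL (leq_trans _ km).
  have [y /andP[y0 yh]] := @MVT_is_derive R (phi (m - k.+1)%N) (phi (m - k.+1).+1) 0 h h0
    (fun y H => phid _ y mk (proj1 (andP H))).
  rewrite phi0 mom0 // mul0r !subr0 => ->.
  by rewrite pmulr_llt0 // subnSK // IH ?(ltnW km) // y0 (lt_trans yh).
have := neg m (leqnn m) (eta / 2); rewrite subnn.
have e20 : 0 < eta / 2 by rewrite divr_gt0.
have e2e : eta / 2 < eta by lra.
rewrite e20 e2e => /(_ isT); apply/negP; rewrite -leNgt.
by rewrite /phi; under eq_bigr do rewrite expr0 mulr1; exact: T0.
Qed.

Lemma antiderivative (R : realType) (f : R -> R) (a b : R) : a < b ->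
  (forall x, a < x -> {for x, continuous f}) ->
  exists F : R -> R, forall x, b < x -> is_derive x 1 F (f x).
Proof.
move=> ab fc.
exists (fun x => (\int[lebesgue_measure]_(t in [set` `[b, x]]) (f t))%R) => x bx.
have [||||dF Fx] := @continuous_FTC1_closed R f b x (x + 1).
- by rewrite ltrDl.
- apply: continuous_compact_integrable; first exact: segment_compact.
  apply: continuous_in_subspaceT => y; rewrite inE /= in_itv /= => /andP[by_ _].
  by apply: fc; exact: lt_le_trans by_.
- exact: bx.
- by apply: fc; exact: lt_trans bx.
by apply: DeriveDef dF _; rewrite -derive1E.
Qed.

(** The base point of each integral must lie inside the region of continuity, so every integration
    gives up part of the domain; stopping halfway to [b] leaves room for the next one. *)
Lemma iterated_antiderivative (R : realType) (m : nat) (f : R -> R) (a b : R) : a < b ->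
  (forall x, a < x -> {for x, continuous f}) ->
  exists G : nat -> R -> R, G m = f /\
    forall l, (l < m)%N -> forall x, b < x -> is_derive x 1 (G l) (G l.+1 x).
Proof.
elim: m f a => [|m IH] f a ab fc; first by exists (fun _ => f).
pose mid := (a + b) / 2.
have am : a < mid by rewrite /mid; lra.
have mb : mid < b by rewrite /mid; lra.
have [F Fd] := antiderivative R f a mid am fc.
have [G [Gm Gd]] := IH F mid mb (fun x mx => is_derive_continuous R F x _ (Fd x mx)).
exists (fun l => if l == m.+1 then f else G l); rewrite eqxx; split => // l.
rewrite ltnS leq_eqVlt => /predU1P[->|lm] x bx.
  by rewrite eqxx ltn_eqF // Gm; apply: Fd; exact: lt_trans bx.
by rewrite (ltn_eqF (ltnW lm : (l < m.+1)%N)) eqSS (ltn_eqF lm); exact: Gd.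
Qed.

(** Let [G 0] be a [size hs]-fold antiderivative of [f]. The weighted sum of its translates has a
    nonnegative derivative of order [size hs], namely the sum for [f], hence nonnegative mixed
    differences. These commute with the sum, so [fdiff hs (G 0)] satisfies the hypothesis of
    [derive_moment_ge0]. *)
Lemma fdiff_moment_ge0 (R : realType) (I : Type) (r : seq I) (w s : I -> R) (f : R -> R)
    (hs : seq R) :
  (forall i, 0 <= s i) ->
  (forall l, (l < size hs)%N -> \sum_(i <- r) w i * s i ^+ l = 0) ->
  0 < \sum_(i <- r) w i * s i ^+ size hs ->
  (forall x, 0 < x -> {for x, continuous f}) ->
  (forall t h : R, 0 < t -> 0 < h -> 0 <= \sum_(i <- r) w i * f (t + h * s i)) ->
  all (fun h => 0 < h) hs -> forall x, 0 < x -> 0 <= fdiff hs f x.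
Proof.
move=> s0 mom0 momm fc T0 hs0 x x0.
pose c := x / 2.
have c0 : 0 < c by rewrite divr_gt0.
have cx : c < x by rewrite /c; lra.
have [G [Gm Gd]] := iterated_antiderivative R (size hs) f 0 c c0 fc.
rewrite -Gm.
(* [fdiff hs (G 0)] has [m]-th derivative [fdiff hs f], so no limit of regularizations is needed. *)
apply: (derive_moment_ge0 R I r w s (size hs) (fun l => fdiff hs (G l)) c x) => //.
- by move=> l ls; apply: fdiff_is_derive => //; exact: Gd.
- by rewrite Gm; apply: (fdiff_continuous R hs 0).
move=> h h0; rewrite fdiff_sum.
apply: (fdiff_ge0 R hs c (fun l y => \sum_(i <- r) w i * G l (y + h * s i))) => //.
- move=> l ls y cy; apply: is_derive_sumr => i; apply: is_derive_mull.
  apply: is_derive_comp_addr; apply: Gd => //.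
  by rewrite ltr_wpDr // mulr_ge0 // ltW.
- by move=> y cy; rewrite Gm; apply: T0 => //; exact: lt_trans cy.
Qed.

(** * Chord bound and continuity for monotone midpoint-convex functions *)

Lemma discrete_chord (R : realType) (b : nat -> R) :
  (forall i, b i.+1 - b i <= b i.+2 - b i.+1) ->
  forall N i, (i <= N)%N -> N%:R * (b i - b 0%N) <= i%:R * (b N - b 0%N).
Proof.
(* Increments grow, so the average of the first [i] increments is at most the next one. *)
move=> bi; have incr i : b i - b 0%N <= i%:R * (b i.+1 - b i).
  elim: i => [|i IH]; first by rewrite subrr mul0r.
  have h : i.+1%:R * (b i.+1 - b i) <= i.+1%:R * (b i.+2 - b i.+1).
    by rewrite ler_wpM2l.
  by apply: le_trans h; rewrite -natr1 mulrDl mul1r; lra.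
move=> N i; elim: N => [|N IH]; first by rewrite leqn0 => /eqP ->.
rewrite leq_eqVlt => /predU1P[->//|]; rewrite ltnS => iN.
have [N0|N0] := posnP N.
  by move: iN; rewrite N0 leqn0 => /eqP ->; rewrite subrr mulr0 mul0r.
have NR : 0 < N%:R :> R by rewrite ltr0n.
have h1 : N%:R * (b i - b 0%N) * N.+1%:R <= i%:R * (b N - b 0%N) * N.+1%:R.
  by rewrite ler_wpM2r // IH.
have h2 : i%:R * ((b N - b 0%N) * N.+1%:R) <= i%:R * (N%:R * (b N.+1 - b 0%N)).
  apply: ler_wpM2l => //; have := incr N; rewrite -natr1 => h; lra.
rewrite -(ler_pM2l NR); lra.
Qed.

Section monotone_midconvex.
Variables (R : realType) (c : R) (g : R -> R).
Hypothesis gmono : forall x y, c < x -> x <= y -> g x <= g y.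
Hypothesis gmid : forall x h, c < x -> 0 < h -> 2 * g (x + h) <= g x + g (x + 2 * h).

(** Midpoint convexity gives the chord bound on the grid of step [L / N]; monotonicity extends it to
    any [t] by rounding up to the next grid point, at a cost of at most [1 / N] of the total
    increment. Then [N] is taken large. *)
Lemma monotone_midconvex_chord (x L t : R) : c < x -> 0 < L -> 0 <= t <= 1 ->
  g (x + t * L) <= g x + t * (g (x + L) - g x).
Proof.
move=> cx L0 /andP[t0 t1].
have gxL : 0 <= g (x + L) - g x by rewrite subr_ge0 gmono // lerDl ltW.
have approx N : (0 < N)%N -> g (x + t * L) - g x <= (t + N%:R^-1) * (g (x + L) - g x).
  move=> N0; have NR : 0 < N%:R :> R by rewrite ltr0n.
  pose d := L / N%:R; have d0 : 0 < d by rewrite divr_gt0.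
  have chord := @discrete_chord R (fun i => g (x + i%:R * d)) _ N.
  have {}chord i : (i <= N)%N -> N%:R * (g (x + i%:R * d) - g x) <= i%:R * (g (x + L) - g x).
    have NdL : N%:R * d = L by rewrite /d mulrC divfK ?gt_eqF.
    have := chord _ i; rewrite mul0r addr0 NdL; apply.
    move=> j; have cxj : c < x + j%:R * d by apply: ltr_wpDr => //; rewrite mulr_ge0 // ltW.
    have := gmid (x + j%:R * d) d cxj d0.
    have -> : x + j%:R * d + d = x + j.+1%:R * d by rewrite -natr1; ring.
    have -> : x + j%:R * d + 2 * d = x + j.+2%:R * d by rewrite -!natr1; ring.
    by lra.
  have tN0 : 0 <= t * N%:R by rewrite mulr_ge0.
  have /andP[fl1 fl2] := truncn_itv tN0.
  set i := Num.trunc (t * N%:R) in fl1 fl2.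
  (* For [i >= N] the next grid point would lie beyond [x + L], but then [t >= 1] and monotonicity
     suffices. *)
  have [iN|iN] := ltnP i N; last first.
    have : g (x + t * L) <= g (x + L).
      apply: gmono; first by rewrite ltr_wpDr // mulr_ge0 // ltW.
      by rewrite lerD2l ler_piMl // ltW.
    have NtN : N%:R <= t * N%:R by rewrite (le_trans _ fl1) // ler_nat.
    have : 1 <= t by rewrite -(ler_pM2r NR) mul1r.
    have : 0 <= N%:R^-1 :> R by rewrite invr_ge0.
    by nra.
  have := chord _ iN.
  have : g (x + t * L) <= g (x + i.+1%:R * d).
    apply: gmono; first by rewrite ltr_wpDr // mulr_ge0 // ltW.
    rewrite lerD2l /d mulrCA [t * L]mulrC; apply: ler_wpM2l; first exact: ltW.
    by rewrite ler_pdivlMr // ltW.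
  move=> h1 h2; rewrite -(ler_pM2l NR).
  have -> : N%:R * ((t + N%:R^-1) * (g (x + L) - g x)) = (t * N%:R + 1) * (g (x + L) - g x).
    by field; rewrite gt_eqF.
  have h3 : i.+1%:R * (g (x + L) - g x) <= (t * N%:R + 1) * (g (x + L) - g x).
    by apply: ler_wpM2r => //; rewrite -natr1 lerD2r.
  apply: le_trans h3; apply: le_trans h2; rewrite ler_wpM2l // lerD2r //.
rewrite -lerBlDl; set D := g (x + L) - g x in gxL approx *.
apply/ler_addgt0Pr => e e0.
have De : 0 <= D / e by rewrite divr_ge0 // ltW.
have /andP[_] := truncn_itv De; set N := (Num.trunc _).+1 => DN.
have NR : 0 < N%:R :> R by rewrite ltr0n.
apply: le_trans (approx N isT) _; rewrite mulrDl lerD2l.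
by rewrite mulrC ler_pdivrMr // mulrC -ler_pdivrMr // ltW.
Qed.

(** The chord bound controls increments to the right of [x] linearly. Those to the left are no
    larger, by midpoint convexity at [y], [x] and the reflection of [y] in [x]. *)
Lemma monotone_midconvex_continuous (x : R) : c < x -> {for x, continuous g}.
Proof.
move=> cx; pose C := g (x + 1) - g x + 1.
have C0 : 0 < C by rewrite ltr_wpDl // subr_ge0 gmono // lerDl.
have right h : 0 <= h <= 1 -> g (x + h) - g x <= h * C.
  move=> h01; have := monotone_midconvex_chord x 1 h cx ltr01 h01.
  by rewrite mulr1 /C; case/andP: h01 => h0 h1; lra.
have near_dist r : 0 < r -> \forall y \near x, `|y - x| < r.
  by move=> r0; apply/nbhs_ballP; exists r => //= z; rewrite /ball /= distrC.
apply/cvgrPdist_lt => e e0.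
near=> y.
have yx1 : `|y - x| < 1 by near: y; exact: near_dist.
have yxe : `|y - x| < e / C by near: y; apply: near_dist; exact: divr_gt0.
have cy : c < y by near: y; exact: lt_nbhsr.
have yxC : `|y - x| * C < e by rewrite -ltr_pdivlMr.
have [xy|yx] := leP x y.
  have := right (y - x); rewrite subr_ge0 xy addrCA subrr addr0.
  rewrite ger0_norm ?subr_ge0 // in yx1 yxC; rewrite (ltW yx1) => /(_ isT) h.
  by rewrite distrC ger0_norm ?subr_ge0 ?gmono //; lra.
rewrite ltr0_norm ?subr_lt0 // opprB in yx1 yxC.
have := right (x - y); rewrite subr_ge0 (ltW yx) (ltW yx1) => /(_ isT) h.
have xy0 : 0 < x - y by rewrite subr_gt0.
have := gmid y (x - y) cy xy0.
have -> : y + (x - y) = x by ring.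
have -> : y + 2 * (x - y) = x + (x - y) by ring.
have gyx : 0 <= g x - g y by rewrite subr_ge0; apply: gmono => //; exact: ltW.
by rewrite ger0_norm //; lra.
Unshelve. all: by end_near. Qed.

End monotone_midconvex.

(** * Monotonicity and continuity from geometric midpoint inequalities *)

Section geometric_midpoint.
Variables (R : realType) (f : R -> R).
Hypothesis fge0 : forall x, 0 < x -> 0 <= f x.
Hypothesis fgeo : forall x y z, 0 < x -> x < y -> y < z -> y ^+ 2 <= x * z ->
  f y ^+ 2 <= f x * f z.

(* A drop [f y < f x] would force [f] to blow up just to the left of [x]: the ratio
   [f / f y] is at least squared each time one moves left by an arbitrarily small amount. *)
Lemma geometric_midpoint_monotone (x y : R) : 0 < x -> x <= y -> f x <= f y.
Proof.
move=> x0; rewrite le_eqVlt => /predU1P[->//|xy]; rewrite leNgt; apply/negP => fyx.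
have y0 : 0 < y by exact: lt_trans xy.
(* Any [q < x] with [x ^+ 2 <= q * y] would do: then [v ^+ 2 <= u * y] whenever
   [q <= u < v <= x]. *)
pose q := (x ^+ 2 / y + x) / 2.
have qx' : x ^+ 2 / y < x by rewrite ltr_pdivrMr // expr2 ltr_pM2l.
have x2y : 0 < x ^+ 2 / y by rewrite divr_gt0 // exprn_gt0.
have q0 : 0 < q by rewrite /q; lra.
have qx : q < x by rewrite /q; lra.
have qy : x ^+ 2 <= q * y by rewrite -ler_pdivrMr // /q; lra.
have step u v : q <= u -> u < v -> v <= x -> f v ^+ 2 <= f u * f y.
  move=> qu uv vx; apply: fgeo => //; [exact: lt_le_trans qu|exact: le_lt_trans xy|].
  apply: le_trans (_ : x ^+ 2 <= _).
    by rewrite ler_sqr // nnegrE ltW // (lt_trans _ uv) // (lt_le_trans q0).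
  by apply: le_trans qy _; rewrite ler_pM2r.
have fy0 : 0 < f y.
  rewrite lt_def fge0 // andbT; apply/eqP => fy; have := step q x (lexx _) qx (lexx _).
  rewrite fy mulr0 => h; have : f x ^+ 2 = 0 by apply/eqP; rewrite eq_le h sqr_ge0.
  by move/eqP; rewrite sqrf_eq0 => /eqP fx; move: fyx; rewrite fx fy ltxx.
pose rho u := f u / f y.
have rstep u v : q <= u -> u < v -> v <= x -> rho v ^+ 2 <= rho u.
  move=> qu uv vx; rewrite /rho expr_div_n ler_pdivrMr ?exprn_gt0 //.
  by rewrite expr2 mulrA divfK ?gt_eqF // -expr2 step.
pose d := rho x - 1.
have d0 : 0 < d by rewrite subr_gt0 ltr_pdivlMr // mul1r.
(* The bound holds on all of [[q, x)] for every [k]: passing from [v] to a point [u] on its left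
   squares the ratio, which adds at least [d]. At [q] this contradicts the finiteness of [rho q]. *)
have blowup k u : q <= u -> u < x -> 1 + k.+1%:R * d <= rho u.
  elim: k u => [|k IH] u qu ux.
    have := rstep u x qu ux (lexx _); have -> : rho x = 1 + d by rewrite /d; ring.
    by move=> h; apply: le_trans h; nra.
  pose v := (u + x) / 2.
  have uv : u < v by rewrite /v; lra.
  have vx : v < x by rewrite /v; lra.
  have h1 := IH v (ltW (le_lt_trans qu uv)) vx; have h2 := rstep u v qu uv (ltW vx).
  have k0 : 0 <= k%:R * d by rewrite mulr_ge0 // ltW.
  apply: le_trans h2; move: h1; rewrite -!(natr1 k.+1) -!(natr1 k) => h1.
  by nra.
have rd : 0 <= rho q / d by rewrite /rho !divr_ge0 ?fge0 // ltW.
have /andP[_] := truncn_itv rd; set N := Num.trunc _ => rN.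
have := blowup N q (lexx _) qx; rewrite ltr_pdivrMr // in rN; lra.
Qed.

(** In the variable [ln x] geometric midpoints become arithmetic ones, and the inequality of
    arithmetic and geometric means turns [B ^+ 2 <= A * C] into [2 * B <= A + C]; so [f \o expR] is
    monotone and midpoint convex. *)
Lemma geometric_midpoint_continuous (x : R) : 0 < x -> {for x, continuous f}.
Proof.
move=> x0.
have gc : {for ln x, continuous (f \o expR)}.
  apply: (@monotone_midconvex_continuous R (ln x - 1)); last by rewrite ltrBlDr ltrDl.
    move=> u v _ uv; apply: geometric_midpoint_monotone; first exact: expR_gt0.
    by rewrite ler_expR.
  move=> u h _ h0 /=.
  have := fgeo (expR u) (expR (u + h)) (expR (u + 2 * h)) (expR_gt0 _).
  rewrite !ltr_expR ltrDl h0 ltrD2l => /(_ isT).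
  have -> : h < 2 * h by lra.
  move=> /(_ isT); rewrite -expRD expr2 -expRD.
  have -> : u + h + (u + h) = u + (u + 2 * h) by ring.
  move=> /(_ (lexx _)).
  have := fge0 _ (expR_gt0 u); have := fge0 _ (expR_gt0 (u + h)).
  have := fge0 _ (expR_gt0 (u + 2 * h)).
  set A := f (expR u); set B := f (expR (u + h)); set C := f (expR (u + 2 * h)).
  move=> C0 B0 A0 BAC; have AC2 := sqr_ge0 (A - C).
  have : (2 * B) ^+ 2 <= (A + C) ^+ 2 by nra.
  by rewrite ler_sqr // nnegrE ?addr_ge0 ?mulr_ge0.
have fc : {for x, continuous ((f \o expR) \o @ln R)}.
  by apply: continuous_comp gc; exact: continuous_ln.
rewrite /prop_for /continuous_at /= lnK ?posrE // in fc.
apply: cvg_trans fc; apply: near_eq_cvg.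
near=> y; rewrite /= lnK // posrE; near: y; exact: lt_nbhsr.
Unshelve. all: by end_near. Qed.

End geometric_midpoint.

(** * Regularity from nonnegative mixed differences *)

(** A derivative-free form of [f, f', ..., f^(n) >= 0]; the empty list accounts for order 0. *)
Definition monotone_order {R : realType} (n : nat) (f : R -> R) : Prop :=
  forall hs : seq R, (size hs <= n)%N -> all (fun h => 0 < h) hs ->
    forall x, 0 < x -> 0 <= fdiff hs f x.

Definition slope {R : realType} (f : R -> R) (h x : R) : R := (f (x + h) - f x) / h.

Lemma fdiff_ext (R : realType) (hs : seq R) (f g : R -> R) :
  all (fun h => 0 < h) hs -> (forall x, 0 < x -> f x = g x) ->
  forall x, 0 < x -> fdiff hs f x = fdiff hs g x.
Proof.
elim: hs f g => [|h hs IH] f g /=; first by [].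
move=> /andP[h0 hs0] fg; apply: IH => // x x0.
by rewrite /fdelta !fg // addr_gt0.
Qed.

Lemma fdiff_mulr (R : realType) (hs : seq R) (k : R) (f : R -> R) (x : R) :
  fdiff hs (fun x => f x * k) x = fdiff hs f x * k.
Proof.
elim: hs f => [//|h hs IH] f /=; rewrite -IH; congr (fdiff _ _ _).
by apply/funext => y; rewrite /fdelta mulrBl.
Qed.

Lemma fdiff_cvg (R : realType) (hs : seq R) (u : nat -> R -> R) (g : R -> R) :
  all (fun h => 0 < h) hs ->
  (forall x, 0 < x -> u k x @[k --> \oo] --> g x) ->
  forall x, 0 < x -> fdiff hs (u k) x @[k --> \oo] --> fdiff hs g x.
Proof.
elim: hs u g => [|h hs IH] u g /=; first by [].
move=> /andP[h0 hs0] ug; apply: (IH (fun k => fdelta h (u k))) => // x x0.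
by apply: cvgB; apply: ug => //; rewrite addr_gt0.
Qed.

Section monotone_order2.
Variables (R : realType) (f : R -> R).
Hypothesis f2 : monotone_order 2 f.

Lemma monotone_order2_mono (x y : R) : 0 < x -> x <= y -> f x <= f y.
Proof.
move=> x0; rewrite le_eqVlt => /predU1P[->//|xy].
have := f2 [:: y - x] isT; rewrite /= subr_gt0 xy => /(_ isT x x0).
by rewrite /fdelta addrCA subrr addr0 subr_ge0.
Qed.

Lemma monotone_order2_mid (x h : R) : 0 < x -> 0 < h -> 2 * f (x + h) <= f x + f (x + 2 * h).
Proof.
move=> x0 h0; have := f2 [:: h; h] isT; rewrite /= h0 => /(_ isT x x0).
rewrite /fdelta; have -> : x + h + h = x + 2 * h by ring.
by lra.
Qed.

Lemma monotone_order2_continuous (x : R) : 0 < x -> {for x, continuous f}.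
Proof.
exact: (monotone_midconvex_continuous R 0 f monotone_order2_mono monotone_order2_mid).
Qed.

Lemma monotone_order2_chord (x L t : R) : 0 < x -> 0 < L -> 0 <= t <= 1 ->
  f (x + t * L) <= f x + t * (f (x + L) - f x).
Proof.
exact: (monotone_midconvex_chord R 0 f monotone_order2_mono monotone_order2_mid).
Qed.

Lemma monotone_order2_convex : convex_on f [set x | 0 < x].
Proof.
move=> x y t /= x0 y0 t0 t1.
have [xy|yx|->] := ltgtP x y.
- have := monotone_order2_chord x (y - x) (1 - t) x0.
  rewrite subr_gt0 xy => /(_ isT); rewrite addrCA subrr addr0.
  have -> : x + (1 - t) * (y - x) = t * x + (1 - t) * y by ring.
  have -> : 0 <= 1 - t <= 1 by apply/andP; split; lra.
  by move=> /(_ isT); lra.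
- have := monotone_order2_chord y (x - y) t y0.
  rewrite subr_gt0 yx t0 t1 => /(_ isT isT); rewrite addrCA subrr addr0.
  have -> : y + t * (x - y) = t * x + (1 - t) * y by ring.
  by lra.
- have -> : t * y + (1 - t) * y = y by ring.
  by lra.
Qed.

Lemma slope_le (x h k : R) : 0 < x -> 0 < h -> h <= k -> slope f h x <= slope f k x.
Proof.
move=> x0 h0 hk; have k0 : 0 < k := lt_le_trans h0 hk.
have := monotone_order2_chord x k (h / k) x0 k0.
rewrite divr_ge0 ?(ltW h0) ?(ltW k0) // ler_pdivrMr // mul1r hk => /(_ isT).
rewrite divfK ?gt_eqF // => H.
rewrite /slope ler_pdivrMr // lerBlDl.
by have -> : (f (x + k) - f x) / k * h = h / k * (f (x + k) - f x) by ring.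
Qed.

Lemma slope_shift (x h k : R) : 0 < x -> 0 < h -> 0 < k ->
  slope f h x <= slope f k (x + h).
Proof.
move=> x0 h0 k0; have hk0 : 0 < h + k by rewrite addr_gt0.
have := monotone_order2_chord x (h + k) (h / (h + k)) x0 hk0.
rewrite divr_ge0 ?(ltW h0) ?(ltW hk0) // ler_pdivrMr // mul1r lerDl (ltW k0) => /(_ isT).
rewrite divfK ?gt_eqF // /slope addrA.
set A := f x; set B := f (x + h); set C := f (x + h + k) => H.
have {}H : (B - A) * (h + k) <= h * (C - A).
  by rewrite -ler_pdivlMr // mulrAC lerBlDl.
by rewrite ler_pdivrMr // mulrAC ler_pdivlMr //; lra.
Qed.

Lemma slope_ge0 (x h : R) : 0 < x -> 0 < h -> 0 <= slope f h x.
Proof.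
move=> x0 h0; rewrite divr_ge0 ?(ltW h0) // subr_ge0 monotone_order2_mono //.
by rewrite lerDl ltW.
Qed.

End monotone_order2.

Lemma monotone_order_le (R : realType) (m n : nat) (f : R -> R) :
  (m <= n)%N -> monotone_order n f -> monotone_order m f.
Proof. by move=> mn fn hs hsm; apply: fn; exact: leq_trans mn. Qed.

Lemma monotone_order_ext (R : realType) (n : nat) (f g : R -> R) :
  (forall x, 0 < x -> f x = g x) -> monotone_order n f -> monotone_order n g.
Proof.
by move=> fg fn hs hsn hs0 x x0; rewrite -(fdiff_ext R hs f g) // fn.
Qed.

(** By convexity the slopes decrease to a right derivative [g] as the step shrinks. Mixed
    differences of [g] are limits of rescaled differences of [f] of one order more, so [g] has order
    at least 2 and is continuous; squeezing slopes between [g x] and [g (x + h)] makes [g] the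
    two-sided derivative. *)
Lemma monotone_orderS_derive (R : realType) (n : nat) (f : R -> R) :
  monotone_order n.+3 f ->
  (forall x, 0 < x -> derivable f x 1) /\ monotone_order n.+2 (derive1 f).
Proof.
move=> fn; have f2 : monotone_order 2 f by exact: monotone_order_le fn.
pose e (k : nat) : R := k.+1%:R^-1.
have e0 k : 0 < e k by rewrite invr_gt0.
(* The right derivative of [f]. *)
pose g x := limn (fun k => slope f (e k) x).
have decr (x : R) : 0 < x -> nonincreasing_seq (fun k => slope f (e k) x).
  by move=> x0 i j ij; apply: slope_le => //; rewrite lef_pV2 ?posrE // ler_nat.
have gcvg (x : R) : 0 < x -> slope f (e k) x @[k --> \oo] --> g x.
  move=> x0; apply: nonincreasing_is_cvgn; first exact: decr.
  by exists 0 => _ [k _ <-]; exact: slope_ge0.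
have g_le (x h : R) : 0 < x -> 0 < h -> g x <= slope f h x.
  move=> x0 h0; have hk := truncnS_gt h^-1; set k := Num.trunc _ in hk.
  apply: le_trans (_ : slope f (e k) x <= _).
    by apply: (nonincreasing_cvgn_ge (decr x x0)); apply: cvgP (gcvg x x0).
  apply: slope_le => //; rewrite /e -[h]invrK lef_pV2 ?posrE ?invr_gt0 //.
  exact: ltW.
have g_ge (x h : R) : 0 < x -> 0 < h -> slope f h x <= g (x + h).
  move=> x0 h0; have xh0 : 0 < x + h by rewrite addr_gt0.
  apply: limr_ge; first exact: cvgP (gcvg _ xh0).
  by near=> k; exact: slope_shift.
have gn : monotone_order n.+2 g.
  move=> hs hsn hs0 x x0.
  have := fdiff_cvg R hs (fun k => slope f (e k)) g hs0 gcvg x x0.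
  move=> gl; rewrite -(cvg_lim _ gl) //; apply: limr_ge; first exact: cvgP gl.
  near=> k; rewrite /slope fdiff_mulr divr_ge0 ?(ltW (e0 _)) //.
  by apply: (fn (e k :: hs)) => //=; rewrite e0.
have g2 : monotone_order 2 g by exact: monotone_order_le gn.
have fg (x : R) : 0 < x -> is_derive x 1 f (g x).
  move=> x0.
  suff fl : h^-1 *: (f (h *: 1 + x) - f x) @[h --> 0^'] --> g x.
    apply: DeriveDef; first exact: cvgP fl.
    by apply: cvg_lim.
  have gc := monotone_order2_continuous R g g2 x x0.
  apply/cvgrPdist_lt => eps eps0.
  have /cvgrPdist_lt/(_ _ eps0)/nbhs_ballP[d /= d0 dP] := gc.
  (* The bound by [x] keeps [x + h] positive when [h] is negative. *)
  apply/nbhs_ballP; exists (Num.min d x); first by rewrite /= lt_min d0.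
  move=> h; rewrite /ball /= sub0r normrN lt_min => /andP[hd hx] hn0.
  have := dP (x + h); rewrite /ball /= opprD addNKr normrN => /(_ hd).
  rewrite /GRing.scale /= mulr1 [h + x]addrC mulrC -/(slope f h x).
  have [h0|h0|hE] := ltgtP h 0; last by move: hn0; rewrite hE eqxx.
  - have xh0 : 0 < x + h by move: hx; rewrite ltr0_norm // => ?; lra.
    have nh0 : 0 < - h by rewrite oppr_gt0.
    have := g_le (x + h) (- h) xh0 nh0; have := g_ge (x + h) (- h) xh0 nh0.
    have -> : slope f (- h) (x + h) = slope f h x.
      by rewrite /slope addrK invrN mulrN -mulNr opprB.
    rewrite addrK => h1 h2; rewrite !ger0_norm; lra.
  - have := g_le x h x0 h0; have := g_ge x h x0 h0 => h1 h2.
    rewrite !ler0_norm; lra.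
split=> [x x0|]; first by have [] := fg x x0.
apply: monotone_order_ext gn => x x0; rewrite derive1E.
by have [_ ->] := fg x x0.
Unshelve. all: by end_near. Qed.

Lemma monotone_order_smooth (R : realType) (n : nat) (f : R -> R) :
  monotone_order n.+2 f ->
  [/\ Ck_on n f [set x | 0 < x],
      convex_on (derive1n n f) [set x | 0 < x] &
      forall j, (j <= n)%N -> forall x : R, 0 < x -> 0 <= derive1n j f x].
Proof.
elim: n f => [|n IH] f fn.
  split; first by split => // x; exact: (monotone_order2_continuous R f fn).
    exact: (monotone_order2_convex R f fn).
  by move=> j; rewrite leqn0 => /eqP -> x x0; exact: (fn [::]).
have [fd dfn] := monotone_orderS_derive R n f fn.
have [[dd dc] dconv dge] := IH _ dfn.
split.
- split=> [[|j] jn x x0|x x0]; first exact: fd.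
    by rewrite derive1Sn; exact: dd.
  by rewrite derive1Sn; exact: dc.
- by rewrite derive1Sn.
- move=> [|j] jn x x0; first exact: (fn [::]).
  by rewrite derive1Sn; exact: dge.
Qed.

(** * From total nonnegativity to smoothness, convexity and signs *)

Theorem mainTheorem14 (R : realType) (f : R -> R) (X0 : set R) (p : nat) :
  is_interval X0 ->
  (exists a b : R, [/\ a < b, X0 a & X0 b]) ->
  (3 <= p)%N ->
  (forall u1 u2 c1 c2 : R, 0 < u1 -> 0 < u2 -> 0 <= c1 -> 0 <= c2 ->
     0 < c1 + c2 ->
     TN p X0 (fun x y => f (c1 * u1 `^ (x + y) + c2 * u2 `^ (x + y)))) ->
  [/\ Ck_on (p - 3) f [set x | 0 < x],
      convex_on (derive1n (p - 3) f) [set x | 0 < x],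
      (forall j : nat, (j <= p - 3)%N -> forall x : R, 0 < x -> 0 <= derive1n j f x)
    & (Ck_on (p - 1) f [set x | 0 < x] ->
       forall x : R, 0 < x ->
         0 <= derive1n (p - 2) f x /\ 0 <= derive1n (p - 1) f x)].
Proof.
move=> X0itv X0ab p3 HTN.
have Hdet := TN_rank_two_det R f X0 p X0itv X0ab HTN.
have fge0 (x : R) : 0 < x -> 0 <= f x.
  move=> x0; have := Hdet 0 x 1%N (fun=> 1) (lexx _) x0.
  rewrite (leq_trans _ p3) // det_mx11 mxE add0r !mulr1; apply => //.
  by move=> i j; rewrite !ord1.
have fgeo (x y z : R) : 0 < x -> x < y -> y < z -> y ^+ 2 <= x * z -> f y ^+ 2 <= f x * f z.
  (* The matrix with rows [x, y] and [y, z] is to be [t + h * (v i * v j)]. Subtracting [t] must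
     leave determinant 0, whence [t = (x * z - y ^+ 2) / D]; then [h = D^-1] and
     [v = (y - x, z - y)]. Positivity of [D] also says that [v] is increasing. *)
  move=> x0 xy yz yxz; pose D := x + z - 2 * y.
  have D0 : 0 < D.
    have h : 2 * y < x + z.
      rewrite -ltr_sqr ?nnegrE; [|lra|lra].
      have : 0 < (z - x) ^+ 2 by rewrite exprn_gt0 // subr_gt0 (lt_trans xy).
      by nra.
    by rewrite /D subr_gt0.
  pose t := (x * z - y ^+ 2) / D.
  have t0 : 0 <= t by rewrite divr_ge0 ?(ltW D0) // subr_ge0.
  pose v (i : 'I_2) := if i == ord0 then y - x else z - y.
  have := Hdet t D^-1 2%N v t0; rewrite invr_gt0 => /(_ D0).
  rewrite (leq_trans _ p3) // => /(_ isT).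
  rewrite (expand_det_row _ ord0) !big_ord_recl big_ord0.
  rewrite /cofactor !det_mx11 !mxE /= /bump /= expr0 expr1.
  have -> : v ord0 = y - x by [].
  have vE j : v (lift ord0 j) = z - y by [].
  rewrite !vE; have Dn0 : D != 0 by rewrite gt_eqF.
  have -> : t + D^-1 * ((y - x) * (y - x)) = x by rewrite /t /D; field.
  have -> : t + D^-1 * ((z - y) * (z - y)) = z by rewrite /t /D; field.
  have -> : t + D^-1 * ((y - x) * (z - y)) = y by rewrite /t /D; field.
  have -> : t + D^-1 * ((z - y) * (y - x)) = y by rewrite /t /D; field.
  move=> H; rewrite -subr_ge0; apply: le_trans (H _ _) _; last by rewrite expr2; lra.
  - by move=> i; rewrite /v; case: ifP => _; rewrite subr_gt0.
  - move=> [[|[|i]] //= hi] [[|[|j]] //= hj] // _; rewrite /v /=; rewrite /D in D0; lra.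
have fc := geometric_midpoint_continuous R f fge0 fgeo.
have weights m : (m < p)%N -> exists w s : 'I_m.+1 * 'I_m.+1 -> R,
  [/\ forall i, 0 <= s i,
      forall l, (l < m)%N -> \sum_i w i * s i ^+ l = 0,
      0 < \sum_i w i * s i ^+ m &
      forall t h : R, 0 < t -> 0 < h -> 0 <= \sum_i w i * f (t + h * s i)].
  move=> mp; have [a [a0 am]] := vanishing_moments R m.
  exists (fun i : 'I_m.+1 * 'I_m.+1 => a i.1 * a i.2),
    (fun i : 'I_m.+1 * 'I_m.+1 => i.1.+1%:R * i.2.+1%:R).
  (* With product weights at product nodes, each moment is the square of the corresponding moment of
     [a]. *)
  have sqr l : \sum_(i : 'I_m.+1 * 'I_m.+1) a i.1 * a i.2 * (i.1.+1%:R * i.2.+1%:R) ^+ l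
      = (\sum_(j < m.+1) a j * j.+1%:R ^+ l) ^+ 2.
    rewrite expr2 big_distrlr pair_bigA /=; apply: eq_bigr => i _.
    by rewrite exprMn; ring.
  split=> [i|l lm||t h t0 h0].
  - by rewrite mulr_ge0.
  - by rewrite sqr a0 // expr2 mulr0.
  - by rewrite sqr am expr1n.
  - by apply: (TN_quad_form R f p) => //; exact: ltW.
have fn : monotone_order (p - 3).+2 f.
  move=> hs hsn hs0 x x0.
  (* As [3 <= p], [(p - 3).+2] equals [p - 1], the largest order the minors of size [p] reach. *)
  have hsp : (size hs < p)%N by lia.
  have [w [s [s0 mom0 momm T0]]] := weights _ hsp.
  exact (fdiff_moment_ge0 R _ _ w s f hs s0 mom0 momm fc T0 hs0 x x0).
have [Ck conv ge0] := monotone_order_smooth R (p - 3) f fn.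
split=> // -[fd fcont] x x0.
(* For smooth [f] the moment argument applies to the derivatives of [f] themselves, up to order
   [p - 1]. *)
have top m : (m <= p - 1)%N -> 0 <= derive1n m f x.
  move=> mp; have mp' : (m < p)%N by lia.
  have mc : {for x, continuous (derive1n m f)}.
    move: mp; rewrite leq_eqVlt => /predU1P[->|mp]; first exact: fcont.
    by apply/differentiable_continuous/derivable1_diffP; exact: fd.
  have [w [s [s0 mom0 momm T0]]] := weights _ mp'.
  have fd' l : (l < m)%N -> forall y : R, 0 < y ->
      is_derive y 1 (derive1n l f) (derive1n l.+1 f y).
    move=> lm y y0; apply: DeriveDef; first by apply: fd => //; exact: leq_trans mp.
    by rewrite derive1nS derive1E.
  exact (derive_moment_ge0 R _ _ w s m (fun l => derive1n l f) 0 x s0 mom0 momm x0 fd' mc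
    (fun h => T0 x h x0)).
by split; apply: top; lia.
Qed.
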